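(* A metric space $X$ is compact if and only if it is Bourbaki quasi-precompact and Bourbaki quasi-complete.
   Context: Let $(X,d)$ be a metric space. $B_\varepsilon(x)$ is the open ball with centre $x$ and radius $\varepsilon>0$; for $A\subseteq X$, $A^{\varepsilon}=\bigcup_{x\in A}B_\varepsilon(x)$. Put $B^1_\varepsilon(x)=B_\varepsilon(x)$, $B^n_\varepsilon(x)=(B^{n-1}_\varepsilon(x))^{\varepsilon}$ for $n\ge 2$, and $B^\infty_\varepsilon(x)=\bigcup_{n\in\mathbb{N}}B^n_\varepsilon(x)$ (the set of points that can be joined to $x$ by a finite chain in $X$ whose consecutive points are at distance $<\varepsilon$). $X$ is Bourbaki quasi-precompact if for every $\varepsilon>0$ there are finitely many points $p_1,\dots,p_k\in X$ with $X=\bigcup_{i=1}^k B^\infty_\varepsilon(p_i)$. A sequence $(x_n)$ is Bourbaki quasi-Cauchy in $X$ if for every $\varepsilon>0$ there exist $n_0\in\mathbb{N}$ and $p\in X$ such that $x_n\in B^\infty_\varepsilon(p)$ for every $n\ge n_0$. $X$ is Bourbaki quasi-complete if every Bourbaki quasi-Cauchy sequence in $X$ has a cluster point in $X$ (equivalently, a convergent subsequence). *)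

(* Defs.v *)
From mathcomp Require Import all_boot all_order all_algebra.
From mathcomp Require Import all_classical all_reals all_analysis.

Set Implicit Arguments.
Unset Strict Implicit.
Unset Printing Implicit Defensive.

Import Order.TTheory GRing.Theory Num.Theory.

Local Open Scope classical_set_scope.
Local Open Scope ring_scope.

(* A^e; in a metricType, ball x e = [set y | mdist x y < e] (ballEmdist). *)
Definition enlargement (R : realType) (X : metricType R) (e : R) (A : set X) :
    set X :=
  \bigcup_(x in A) ball x e.

(* B^n_e(x), meaningful for n >= 1: B^1_e(x) is the ball and
   B^(n+1)_e(x) = (B^n_e(x))^e. *)
Definition chain_ball (R : realType) (X : metricType R) (e : R) (n : nat)
    (x : X) : set X :=
  iter n.-1 (enlargement e) (ball x e).

Definition chain_component (R : realType) (X : metricType R) (e : R) (x : X) :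
    set X :=
  \bigcup_(n in [set n : nat | (1 <= n)%N]) chain_ball e n x.

(* k = 0 is allowed, so the empty space is covered. *)
Definition bourbaki_quasi_precompact (R : realType) (X : metricType R) : Prop :=
  forall e : R, 0 < e ->
    exists (k : nat) (p : 'I_k -> X),
      [set: X] = \bigcup_(i in [set: 'I_k]) chain_component e (p i).

Definition bourbaki_quasi_cauchy (R : realType) (X : metricType R)
    (u : nat -> X) : Prop :=
  forall e : R, 0 < e ->
    exists (n0 : nat) (p : X),
      forall n : nat, (n0 <= n)%N -> chain_component e p (u n).

Definition bourbaki_quasi_complete (R : realType) (X : metricType R) : Prop :=
  forall u : nat -> X, bourbaki_quasi_cauchy u ->
    exists x : X, cluster (u @ \oo) x.

(* Main.v *)
Require Import Defs.
From mathcomp Require Import all_boot all_order all_algebra.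
From mathcomp Require Import all_classical all_reals all_analysis.

(** Let F be an ultrafilter on a Bourbaki quasi-precompact and quasi-complete
    space.  F contains a chain component for every radius, so a sequence whose
    n-th term is chosen in the first n of these components (of radii
    1, 1/2, 1/3, ...), and in any further member of F that may depend on the
    previous terms, is Bourbaki quasi-Cauchy and clusters.  If F contained no
    ball of some radius e, one could choose the sequence e-separated, which is
    impossible; hence F contains balls of all radii, and choosing the terms in
    such balls yields a cluster point to which F converges. *)

Import Order.TTheory GRing.Theory Num.Theory.

Local Open Scope classical_set_scope.
Local Open Scope ring_scope.

(** Dependent choice with full memory: a choice function is iterated on the list of terms built so
    far, so that each term may depend on all earlier ones. *)
Lemma history_choice (T : Type) (P : seq T -> set T) :
  (forall s, P s !=set0) -> exists u : nat -> T, forall n, P (mkseq u n) (u n).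
Proof.
move=> /choice[f Pf].
pose hist n := iter n (fun s => rcons s (f s)) [::].
exists (f \o hist) => n /=.
suff -> : mkseq (f \o hist) n = hist n by exact: Pf.
by elim: n => //= n IHn; rewrite mkseqS IHn.
Qed.

Lemma filter_bigcap_seq (T : Type) (I : eqType) (F : set_system T) (s : seq I)
    (A : I -> set T) :
  Filter F -> (forall i, i \in s -> F (A i)) ->
  F (\bigcap_(i in [set` s]) A i).
Proof.
move=> FF; elim: s => [|j s IHs] FA; first by apply: filterS filterT => x _ i.
have FAs : F (\bigcap_(i in [set` s]) A i).
  by apply: IHs => i si; apply: FA; rewrite inE si orbT.
apply: filterS (filterI (FA j (mem_head j s)) FAs) => x [Aj As] i /=.
by rewrite inE => /predU1P[->//|si]; exact: As.
Qed.

(** If no [A i] belonged to [F], then [F] would contain all the complements, hence their finite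
    intersection, which is disjoint from the union. *)
Lemma ultra_bigcup_ord (T : Type) (F : set_system T) (k : nat)
    (A : 'I_k -> set T) :
  UltraFilter F -> F (\bigcup_(i in [set: 'I_k]) A i) -> exists i, F (A i).
Proof.
move=> FU FA; apply: contrapT => nA.
have FnA i : F (~` A i).
  by have [FAi|//] := in_ultra_setVsetC (A i) FU; case: nA; exists i.
have /(filterI FA)/filter_ex[x [[i _ Ai] nAx]] :
    F (\bigcap_(i in [set` enum 'I_k]) ~` A i).
  by apply: filter_bigcap_seq.
by apply: (nAx i) => //=; rewrite mem_enum.
Qed.

Section BourbakiQuasi.
Context {R : realType} {X : metricType R}.
Implicit Types (x p : X) (e : R) (u : nat -> X) (F : set_system X).

Lemma enlargement_mono e1 e2 (A B : set X) :
  e1 <= e2 -> A `<=` B -> enlargement e1 A `<=` enlargement e2 B.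
Proof.
by move=> e12 AB y [x Ax xy]; exists x; [exact: AB|exact: le_ball xy].
Qed.

Lemma chain_component_mono e1 e2 p :
  e1 <= e2 -> chain_component e1 p `<=` chain_component e2 p.
Proof.
move=> e12 y [n n0 yn]; exists n => //.
rewrite /chain_ball in yn *; elim: n.-1 y yn => [|m IHm] y /=.
  exact: le_ball.
exact: enlargement_mono.
Qed.

Lemma ball_chain_component e p : ball p e `<=` chain_component e p.
Proof. by move=> y py; exists 1%N. Qed.

Lemma exists_invS_lt e : 0 < e -> exists N, forall n, (N <= n)%N ->
  n.+1%:R^-1 < e.
Proof.
by move=> e0; have [N _ NP] := near_infty_natSinv_lt (PosNum e0); exists N.
Qed.

Lemma cluster_seq_ball u x e N : cluster (u @ \oo) x -> 0 < e ->
  exists2 n, (N <= n)%N & ball x e (u n).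
Proof.
move=> ux e0.
have uN : (u @ \oo) [set u n | n in [set n | (N <= n)%N]].
  by exists N => // n Nn; exists n.
by have [_ [[n Nn <-] xn]] := ux _ _ uN (nbhsx_ballx x e e0); exists n.
Qed.

(** The ball of radius [e / 2] around the cluster point is visited at some index [i] and again
    strictly after [i]. *)
Lemma cluster_not_separated u x e : cluster (u @ \oo) x -> 0 < e ->
  exists i j, (i < j)%N /\ ball (u i) e (u j).
Proof.
move=> ux e0; have e20 : 0 < e / 2 by rewrite divr_gt0.
have [i _ xi] := cluster_seq_ball u x (e / 2) 0 ux e20.
have [j ij xj] := cluster_seq_ball u x (e / 2) i.+1 ux e20.
by exists i, j; split=> //; exact: ball_splitr xi xj.
Qed.

Lemma ultra_chain_component F e : UltraFilter F ->
  bourbaki_quasi_precompact X -> 0 < e -> exists p, F (chain_component e p).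
Proof.
move=> FU pX e0; have [k [p XE]] := pX e e0.
have [|i Fi] := @ultra_bigcup_ord _ F k (fun i => chain_component e (p i)) FU.
  by rewrite -XE; exact: filterT.
by exists (p i).
Qed.

Lemma ultra_cluster_seq F (D : seq X -> set X) : UltraFilter F ->
  bourbaki_quasi_precompact X -> bourbaki_quasi_complete X ->
  (forall s, F (D s)) ->
  exists u, (forall n, D (mkseq u n) (u n)) /\ exists x, cluster (u @ \oo) x.
Proof.
move=> FU pX cX FD.
have /choice[p Fp] : forall n, exists p, F (chain_component n.+1%:R^-1 p).
  by move=> n; apply: ultra_chain_component.
(* With [size s = n] the indices run over 0, ..., n inclusive, so component [N] contains every term
   from index [N] on. *)
pose C (s : seq X) := \bigcap_(i in [set` iota 0 (size s).+1])
  chain_component i.+1%:R^-1 (p i).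
have FC s : F (C s).
  by apply: filter_bigcap_seq => *; exact: Fp.
have [s|u uP] := @history_choice _ (fun s => D s `&` C s).
  by apply: (@filter_ex _ F); exact: filterI.
exists u; split=> [n|]; first by have [] := uP n.
apply: cX => e e0; have [N NP] := exists_invS_lt e e0.
exists N, (p N) => n Nn; have [_] := uP n.
rewrite /C size_mkseq => /(_ N) uN.
apply: (chain_component_mono _ _ _ (ltW (NP _ (leqnn N)))); apply: uN.
by rewrite /mkset mem_iota.
Qed.

Lemma ultra_small_ball F e : UltraFilter F ->
  bourbaki_quasi_precompact X -> bourbaki_quasi_complete X ->
  0 < e -> exists x, F (ball x e).
Proof.
move=> FU pX cX e0; apply: contrapT => nF.
have FnB x : F (~` ball x e).
  by have [FB|//] := in_ultra_setVsetC (ball x e) FU; case: nF; exists x.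
(* Each term avoids the [e]-balls around all earlier terms. *)
have [s|u [usep [x ux]]] := @ultra_cluster_seq F
  (fun s => \bigcap_(y in [set` s]) ~` ball y e) FU pX cX.
  by apply: filter_bigcap_seq => *; exact: FnB.
have [i [j [ij uij]]] := cluster_not_separated u x e ux e0.
by apply: (usep j (u i)) => //=; apply: map_f; rewrite mem_iota.
Qed.

Lemma bourbaki_quasi_compact : bourbaki_quasi_precompact X ->
  bourbaki_quasi_complete X -> compact [set: X].
Proof.
move=> pX cX; rewrite compact_ultra => F FU _.
have /choice[q Fq] : forall n, exists q, F (ball q n.+1%:R^-1).
  by move=> n; apply: ultra_small_ball.
have [s|u [uq [x ux]]] := @ultra_cluster_seq F
  (fun s => ball (q (size s)) (size s).+1%:R^-1) FU pX cX.
  exact: Fq.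
exists x; split=> //; apply/fcvg_ballP => e e0.
have e20 : 0 < e / 2 by rewrite divr_gt0.
have e40 : 0 < e / 2 / 2 by rewrite divr_gt0.
have [N NP] := exists_invS_lt _ e40.
(* The ball chosen around [q n] belongs to [F], contains [u n] and has radius below [e / 4]. Its
   points are thus within [e / 2] of [u n], which is itself within [e / 2] of [x]. *)
have [n Nn xn] := cluster_seq_ball u x (e / 2) N ux e20.
apply: filterS (Fq n) => y qy.
have := uq n; rewrite size_mkseq => qun.
apply: (ball_split xn); apply: (@ball_splitr _ _ (q n)).
  exact: le_ball (ltW (NP _ Nn)) _ qun.
exact: le_ball (ltW (NP _ Nn)) _ qy.
Qed.

(** If no finite list of components covers the space, successive points can be chosen outside the
    components of the earlier ones. Components contain balls, so this sequence is [e]-separated and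
    cannot cluster. *)
Lemma compact_bourbaki_quasi_precompact :
  compact [set: X] -> bourbaki_quasi_precompact X.
Proof.
move=> cX e e0.
have [[s sX]|nX] := pselect (exists s : seq X,
    forall y, exists2 p, p \in s & chain_component e p y).
  exists (size s), (tnth (in_tuple s)); apply/seteqP; split=> // y _.
  by have [_ /(tnthP (in_tuple s))[i ->] yi] := sX y; exists i.
have [s|u usep] := @history_choice _
    (fun s => [set y | forall p, p \in s -> ~ chain_component e p y]).
  apply: contrapT => s0; apply: nX; exists s => y.
  apply: contrapT => ys; apply: s0; exists y => p sp yp.
  by apply: ys; exists p.
have [|x [_ ux]] := cX (u @ \oo) _; first exact: filterT.
have [i [j [ij uij]]] := cluster_not_separated u x e ux e0.
case: (usep j (u i)); first by apply: map_f; rewrite mem_iota.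
exact: ball_chain_component.
Qed.

Lemma compact_bourbaki_quasi_complete :
  compact [set: X] -> bourbaki_quasi_complete X.
Proof.
move=> cX u _; have [|x [_ ux]] := cX (u @ \oo) _; first exact: filterT.
by exists x.
Qed.

End BourbakiQuasi.

Theorem theorem2p5 (R : realType) (X : metricType R) :
  compact [set: X] <->
  bourbaki_quasi_precompact X /\ bourbaki_quasi_complete X.
Proof.
split=> [cX|[pX cX]]; last exact: bourbaki_quasi_compact.
split; first exact: compact_bourbaki_quasi_precompact.
exact: compact_bourbaki_quasi_complete.
Qed.
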